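(* Let $A$ be a real Banach algebra and $n\ge1$ an integer. Assume that the condensed abelian groups $K_{-n}(A)$, $K_{-n+1}(A)$, and $K_{-n}(\mathcal{C}([0,1];A))$ are discrete. Then the tautological map $K_{-n}(A)( * )\to K_{-n}(\mathcal{C}([0,1];A))( * )$ of abelian groups is an isomorphism.
   Context: A compactum is a compact Hausdorff space. For an infinite strong limit cardinal $\kappa$, let $\mathrm{EDis}_\kappa$ be the category of extremally disconnected compacta of cardinality $<\kappa$. A $\kappa$-condensed abelian group is a finite-product-preserving functor $\mathrm{EDis}_\kappa^{\mathrm{op}}\to\mathrm{Ab}$; condensed abelian groups form the colimit over $\kappa$ along the (fully faithful) left adjoints of restriction, i.e. they are the finite-product-preserving functors $\mathrm{EDis}^{\mathrm{op}}\to\mathrm{Ab}$ left Kan extended from some $\mathrm{EDis}_\kappa$. Abelian groups embed fully faithfully as the $\aleph_0$-condensed objects; a condensed abelian group in the essential image is called discrete. $\mathcal{C}(S;A)$ is the Banach algebra of continuous functions $S\to A$ for a compactum $S$. $K_m$ denotes the $m$-th (nonconnective) algebraic $K$-group. For a real Banach algebra $B$, the condensed abelian group $K_m(B)$ is $S\mapsto K_m(\mathcal{C}(S;B))$ for $S$ extremally disconnected; its value at the point $*$ is the usual algebraic $K$-group $K_m(B)$ of the underlying ring. The tautological map is induced by the inclusion of constant functions $A\to\mathcal{C}([0,1];A)$. *)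

(* Defs.v *)
From HB Require Import structures.
From mathcomp Require Import all_boot all_order all_algebra finmap.
From mathcomp Require Import all_classical all_reals all_analysis.
From mathcomp Require Import ring lra.
From mathcomp.multinomials Require Import freeg.

Set Implicit Arguments.
Unset Strict Implicit.
Unset Printing Implicit Defensive.

Import Order.TTheory GRing.Theory Num.Theory numFieldNormedType.Exports.

Local Open Scope classical_set_scope.
Local Open Scope ring_scope.

Record category := Category {
  ob :> Type;
  hom : ob -> ob -> Type;
  idm : forall x, hom x x;
  cmp : forall x y z, hom y z -> hom x y -> hom x z;
  cmp_idl : forall x y (f : hom x y), cmp (idm y) f = f;
  cmp_idr : forall x y (f : hom x y), cmp f (idm x) = f;
  cmpA : forall x y z w (h : hom z w) (g : hom y z) (f : hom x y),
    cmp h (cmp g f) = cmp (cmp h g) f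
}.
Arguments cmp {c x y z} g f.

Definition opcat (C : category) : category :=
  @Category C (fun x y => hom y x) (@idm C) (fun x y z g f => cmp f g)
    (fun x y f => cmp_idr f) (fun x y f => cmp_idl f)
    (fun x y z w h g f => esym (cmpA f g h)).

Definition fullsub (C : category) (P : C -> Prop) : category :=
  @Category {x : C | P x} (fun x y => hom (sval x) (sval y))
    (fun x => idm (sval x)) (fun x y z g f => cmp g f)
    (fun x y f => cmp_idl f) (fun x y f => cmp_idr f)
    (fun x y z w h g f => cmpA h g f).

Record functor (C D : category) := Functor {
  fob :> C -> D;
  fmap : forall x y, hom x y -> hom (fob x) (fob y);
  fmap_id : forall x, fmap (idm x) = idm (fob x);
  fmap_cmp : forall x y z (g : hom y z) (f : hom x y),
    fmap (cmp g f) = cmp (fmap g) (fmap f)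
}.
Arguments fmap {C D} F {x y} f : rename.

Record nattrans (C D : category) (F G : functor C D) := NatTrans {
  component :> forall x, hom (F x) (G x);
  naturality : forall x y (f : hom x y),
    cmp (component y) (fmap F f) = cmp (fmap G f) (component x)
}.

Section functor_comp.
Context (C D E : category).

Lemma fcmp_id (G : functor D E) (F : functor C D) x :
  fmap G (fmap F (idm x)) = idm (G (F x)).
Proof. by rewrite !fmap_id. Qed.

Lemma fcmp_cmp (G : functor D E) (F : functor C D) x y z
    (g : hom y z) (f : hom x y) :
  fmap G (fmap F (cmp g f)) = cmp (fmap G (fmap F g)) (fmap G (fmap F f)).
Proof. by rewrite !fmap_cmp. Qed.

Definition fcmp (G : functor D E) (F : functor C D) : functor C E :=
  @Functor C E (fun x => G (F x)) (fun x y f => fmap G (fmap F f))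
    (@fcmp_id G F) (@fcmp_cmp G F).

Lemma whisker_natural (G : functor D E) (F F' : functor C D)
    (t : nattrans F F') x y (f : hom x y) :
  cmp (fmap G (t y)) (fmap (fcmp G F) f) =
  cmp (fmap (fcmp G F') f) (fmap G (t x)).
Proof. by rewrite /= -!fmap_cmp naturality. Qed.

Definition whisker (G : functor D E) (F F' : functor C D)
    (t : nattrans F F') : nattrans (fcmp G F) (fcmp G F') :=
  @NatTrans C E (fcmp G F) (fcmp G F') (fun x => fmap G (t x))
    (@whisker_natural G F F' t).

End functor_comp.

Definition op_incl (C : category) (P : C -> Prop) :
    functor (opcat (fullsub P)) (opcat C) :=
  @Functor (opcat (fullsub P)) (opcat C) sval (fun x y f => f)
    (fun x => erefl) (fun x y z g f => erefl).

(* (F, eta) is the left Kan extension of H along i. *)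
Definition is_left_kan_extension (C D E : category) (i : functor C D)
    (H : functor C E) (F : functor D E) (eta : nattrans H (fcmp F i)) : Prop :=
  forall (G : functor D E) (theta : nattrans H (fcmp G i)),
    exists! beta : nattrans F G, forall c, cmp (beta (i c)) (eta c) = theta c.

Lemma additive_eqP (U V : zmodType) (f g : {additive U -> V}) :
  f =1 g -> f = g.
Proof.
case: f g => [f [[fP]]] [g [[gP]]] /= /funext efg; subst g.
by rewrite (Prop_irrelevance fP gP).
Qed.

Lemma rmorphism_eqP (R S : pzRingType) (f g : {rmorphism R -> S}) :
  f =1 g -> f = g.
Proof.
case: f g => [f [[fP] [fM]]] [g [[gP] [gM]]] /= /funext efg; subst g.
by rewrite (Prop_irrelevance fP gP) (Prop_irrelevance fM gM).
Qed.

Definition Ab : category.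
Proof.
refine (@Category zmodType (fun U V => {additive U -> V}) (fun U => idfun)
  (fun U V W g f => g \o f) _ _ _); by move=> *; apply: additive_eqP.
Defined.

Definition Ring : category.
Proof.
refine (@Category pzRingType (fun R S => {rmorphism R -> S}) (fun R => idfun)
  (fun R S T g f => g \o f) _ _ _); by move=> *; apply: rmorphism_eqP.
Defined.

Definition subgroup (V : zmodType) (M : set V) : Prop :=
  M 0 /\ forall x y, M x -> M y -> M (x - y).

Section zquot.
Context (V : zmodType) (G : set V).

Definition zgen : {pred V} := fun x => `[< smallest (@subgroup V) G x >].

Lemma zgen_zmod_closed : zmod_closed zgen.
Proof.
split=> [|x y]; first by apply/asboolP => M [[]].
move=> /asboolP xG /asboolP yG; apply/asboolP => M MP.
by case: (MP) => -[_ MB] _; apply: MB; [exact: xG | exact: yG].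
Qed.

HB.instance Definition _ := GRing.isZmodClosed.Build V zgen zgen_zmod_closed.

Definition zquot : zmodType := Quotient.quot zgen.
Definition zpi (x : V) : zquot := (\pi_(Quotient.quot zgen) x)%qT.

Lemma zpi_zmod_morphism : zmod_morphism zpi.
Proof. by move=> x y; rewrite /zpi raddfB. Qed.

HB.instance Definition _ :=
  GRing.isZmodMorphism.Build V zquot zpi zpi_zmod_morphism.

Lemma zpi_eq x y : zpi x = zpi y <-> zgen (x - y).
Proof.
rewrite -[zgen _]/(x - y \in zgen) Quotient.idealrBE.
by split=> [?|/eqP//]; apply/eqP.
Qed.

Lemma zpi_surj (q : zquot) : exists x, zpi x = q.
Proof. by exists (repr q); exact: reprK. Qed.

End zquot.

Section zquot_map.
Context (V W : zmodType) (G : set V) (H : set W) (f : {additive V -> W}).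
Hypothesis fGH : forall x, G x -> zgen H (f x).

Lemma zgen_map x : zgen G x -> zgen H (f x).
Proof.
move=> /asboolP /(_ (fun x => zgen H (f x))); apply; split=> //.
have [H0 HB] := zgen_zmod_closed H.
by split=> [|u v]; rewrite ?raddf0 ?raddfB //; exact: HB.
Qed.

Definition zquot_fun (q : zquot G) : zquot H := zpi H (f (repr q)).

Lemma zquot_funE x : zquot_fun (zpi G x) = zpi H (f x).
Proof.
apply/zpi_eq; rewrite -raddfB; apply/zgen_map/zpi_eq; exact: reprK.
Qed.

Lemma zquot_fun_zmod_morphism : zmod_morphism zquot_fun.
Proof.
move=> p q; have [x <-] := zpi_surj p; have [y <-] := zpi_surj q.
by rewrite -raddfB !zquot_funE -raddfB -raddfB.
Qed.

HB.instance Definition _ :=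
  GRing.isZmodMorphism.Build (zquot G) (zquot H) zquot_fun
    zquot_fun_zmod_morphism.

Definition zquot_map : {additive zquot G -> zquot H} := zquot_fun.

End zquot_map.

(* The idempotent e : 'M_n stands for the finitely generated projective left
   module of row vectors R^n e. Matrices a, b with a b = e and b a = f exist if
   and only if R^m e and R^n f are isomorphic (right multiplication by e a f and
   f b e), so K0 below is the group completion of the monoid of isomorphism
   classes of finitely generated projective modules. *)
Record idempotent (R : pzRingType) := Idempotent {
  isize : nat;
  imx :> 'M[R]_isize;
  imx_idem : imx *m imx = imx
}.

HB.instance Definition _ (R : pzRingType) := gen_eqMixin (idempotent R).
HB.instance Definition _ (R : pzRingType) := gen_choiceMixin (idempotent R).

Lemma idempotent_eq (R : pzRingType) n (a b : 'M[R]_n)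
    (aP : a *m a = a) (bP : b *m b = b) :
  a = b -> Idempotent aP = Idempotent bP.
Proof. by move=> ab; subst b; rewrite (Prop_irrelevance aP bP). Qed.

Section idempotent.
Context (R : pzRingType).
Implicit Types e f : idempotent R.

Definition idem_iso e f : Prop :=
  exists (a : 'M[R]_(isize e, isize f)) (b : 'M[R]_(isize f, isize e)),
    a *m b = e /\ b *m a = f.

Lemma idem_sum_subproof e f :
  block_mx e 0 0 f *m block_mx e 0 0 f = block_mx e 0 0 f.
Proof.
by rewrite mulmx_block !imx_idem !mulmx0 !mul0mx !addr0 !add0r.
Qed.

Definition idem_sum e f : idempotent R := Idempotent (idem_sum_subproof e f).

Definition K0_relations : set {freeg (idempotent R)} :=
  [set x | exists e f, idem_iso e f /\ x = << e >> - << f >>] `|`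
  [set x | exists e f, x = << idem_sum e f >> - << e >> - << f >>].

Definition K0 : zmodType := zquot K0_relations.

End idempotent.

Section K0_map.
Context (R S : pzRingType) (phi : {rmorphism R -> S}).

Lemma idem_map_subproof (e : idempotent R) :
  map_mx phi e *m map_mx phi e = map_mx phi e.
Proof. by rewrite -map_mxM imx_idem. Qed.

Definition idem_map (e : idempotent R) : idempotent S :=
  Idempotent (idem_map_subproof e).

Definition freeg_map : {freeg (idempotent R)} -> {freeg (idempotent S)} :=
  fglift (fun e => << idem_map e >>).

Lemma freeg_map_zmod_morphism : zmod_morphism freeg_map.
Proof. exact: lift_is_additive. Qed.

HB.instance Definition _ := GRing.isZmodMorphism.Build
  {freeg (idempotent R)} {freeg (idempotent S)} freeg_map
  freeg_map_zmod_morphism.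

Lemma freeg_mapU e : freeg_map << e >> = << idem_map e >>.
Proof. by rewrite /freeg_map liftU scale1r. Qed.

Lemma idem_map_iso e f : idem_iso e f -> idem_iso (idem_map e) (idem_map f).
Proof.
move=> [a [b [ab ba]]]; exists (map_mx phi a), (map_mx phi b).
by rewrite -!map_mxM ab ba.
Qed.

Lemma idem_map_sum e f :
  idem_map (idem_sum e f) = idem_sum (idem_map e) (idem_map f).
Proof.
by apply: idempotent_eq; rewrite map_block_mx !map_mx0.
Qed.

Lemma K0_relations_map x :
  @K0_relations R x -> zgen (@K0_relations S) (freeg_map x).
Proof.
move=> xR; apply/asboolP; apply: sub_gen_smallest.
case: xR => [[e [f [ef ->]]] | [e [f ->]]]; [left|right].
- exists (idem_map e), (idem_map f); split; first exact: idem_map_iso.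
  by rewrite raddfB /= !freeg_mapU.
- by exists (idem_map e), (idem_map f); rewrite !raddfB /= !freeg_mapU idem_map_sum.
Qed.

Definition K0_map : {additive K0 R -> K0 S} :=
  zquot_map K0_relations_map.

Lemma K0_mapE x :
  K0_map (zpi (@K0_relations R) x) = zpi (@K0_relations S) (freeg_map x).
Proof. exact: (zquot_funE K0_relations_map). Qed.

End K0_map.

Lemma freeg_additive_ext (I : choiceType) (V : zmodType)
    (f g : {additive {freeg I} -> V}) :
  (forall i, f << i >> = g << i >>) -> f =1 g.
Proof.
move=> fg x; rewrite -(freeg_sumE x) !raddf_sum; apply: eq_bigr => i _.
by rewrite -[coeff i x]intz -freegU_mulz !raddfMz fg.
Qed.

Lemma K0_map_id (R : pzRingType) : K0_map (idfun : {rmorphism R -> R}) = idfun.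
Proof.
apply: additive_eqP => q; have [x <-] := zpi_surj q.
rewrite K0_mapE; apply: congr1; move: x.
apply: (@freeg_additive_ext _ _ (freeg_map idfun) idfun) => -[n e eP].
rewrite [LHS]freeg_mapU [RHS]/=; congr (<< _ >>).
by apply: idempotent_eq; rewrite map_mx_id.
Qed.

Lemma K0_map_comp (R S T : pzRingType)
    (psi : {rmorphism S -> T}) (phi : {rmorphism R -> S}) :
  K0_map (psi \o phi) = (K0_map psi \o K0_map phi).
Proof.
apply: additive_eqP => q; have [x <-] := zpi_surj q.
transitivity (K0_map psi (K0_map phi (zpi (@K0_relations R) x))) => //.
rewrite !K0_mapE; apply: congr1; move: x.
suff: freeg_map (psi \o phi) =1 (freeg_map psi \o freeg_map phi) by exact.
apply: freeg_additive_ext => -[n e eP].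
rewrite [LHS]freeg_mapU [RHS]/= !freeg_mapU; congr (<< _ >>).
by apply: idempotent_eq; rewrite /= map_mx_comp.
Qed.

Definition K0_functor : functor Ring Ab :=
  @Functor Ring Ab K0 (fun R S phi => K0_map phi) K0_map_id
    (fun R S T psi phi => K0_map_comp psi phi).

(* R[t, t^-1]: the finitely supported coefficient families, with t central.
   The polynomials of the library need 1 != 0 in R; here the zero ring must be
   allowed, as the ring of continuous functions on the empty compactum. *)
Record laurent (R : pzRingType) := Laurent {
  lcoef :> int -> R;
  lcoef_finite : finite_set [set k | lcoef k != 0]
}.

HB.instance Definition _ (R : pzRingType) := gen_eqMixin (laurent R).
HB.instance Definition _ (R : pzRingType) := gen_choiceMixin (laurent R).

Lemma laurent_eqP (R : pzRingType) (f g : laurent R) : f =1 g -> f = g.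
Proof.
case: f g => [f fP] [g gP] /= /funext fg; subst g.
by rewrite (Prop_irrelevance fP gP).
Qed.

Section laurent_ring.
Context (R : pzRingType).
Implicit Types f g h : laurent R.

Lemma laurent_out f k : k \notin fset_set [set k | f k != 0] -> f k = 0.
Proof.
rewrite in_fset_set ?notin_setE; last exact: lcoef_finite.
by move=> /negP; rewrite negbK => /eqP.
Qed.

Lemma lzero_finite : finite_set [set k : int | (0 : R) != 0].
Proof. by apply: sub_finite_set (finite_set0 _) => k /=; rewrite eqxx. Qed.

Lemma lone_finite : finite_set [set k : int | (k == 0)%:R != 0 :> R].
Proof.
apply: sub_finite_set (finite_set1 (0 : int)) => k /=.
by case: (eqVneq k 0) => // _; rewrite eqxx.
Qed.

Lemma lopp_finite f : finite_set [set k | - f k != 0].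
Proof.
by apply: sub_finite_set (lcoef_finite f) => k /=; rewrite oppr_eq0.
Qed.

Lemma ladd_finite f g : finite_set [set k | f k + g k != 0].
Proof.
apply: (@sub_finite_set _ _ ([set k | f k != 0] `|` [set k | g k != 0])).
  move=> k /= fg; have [fk|] := eqVneq (f k) 0; last by left.
  by right; rewrite fk add0r in fg.
by rewrite finite_setU; split; exact: lcoef_finite.
Qed.

Definition lzero : laurent R := Laurent lzero_finite.
Definition lone : laurent R := Laurent lone_finite.
Definition lopp f : laurent R := Laurent (lopp_finite f).
Definition ladd f g : laurent R := Laurent (ladd_finite f g).

Lemma laddA : associative ladd.
Proof. by move=> f g h; apply: laurent_eqP => k /=; rewrite addrA. Qed.
Lemma laddC : commutative ladd.
Proof. by move=> f g; apply: laurent_eqP => k /=; rewrite addrC. Qed.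
Lemma ladd0 : left_id lzero ladd.
Proof. by move=> f; apply: laurent_eqP => k /=; rewrite add0r. Qed.
Lemma laddN : left_inverse lzero lopp ladd.
Proof. by move=> f; apply: laurent_eqP => k /=; rewrite addNr. Qed.

HB.instance Definition _ :=
  GRing.isZmodule.Build (laurent R) laddA laddC ladd0 laddN.

Definition lconv (u v : int -> R) (k : int) : R :=
  \sum_(i \in [set: int]) u i * v (k - i).

Lemma lconvE f (v : int -> R) (A : {fset int}) k :
  (forall i, i \notin A -> f i = 0) ->
  lconv f v k = \sum_(i <- A) f i * v (k - i).
Proof. by move=> fA; apply: fsbigTE => i /fA ->; rewrite mul0r. Qed.

Lemma lmul_finite f g : finite_set [set k | lconv f g k != 0].
Proof.
apply: (@sub_finite_set _ _
  ((fun p => p.1 + p.2) @` ([set k | f k != 0] `*` [set k | g k != 0]))).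
  move=> k /= fgk; apply: contrapT => nk; move/eqP: fgk; apply.
  apply: fsbig1 => i _; have [->|fi] := eqVneq (f i) 0; first by rewrite mul0r.
  have [->|gi] := eqVneq (g (k - i)) 0; first by rewrite mulr0.
  by exfalso; apply: nk; exists (i, k - i) => //=; rewrite addrC subrK.
by apply/finite_image/finite_setX; exact: lcoef_finite.
Qed.

Definition lmul f g : laurent R := Laurent (lmul_finite f g).

Lemma lmulA : associative lmul.
Proof.
move=> f g h; apply: laurent_eqP => k /=.
set F := fset_set [set k | f k != 0].
have fF i : i \notin F -> f i = 0 by exact: laurent_out.
rewrite (lconvE _ _ fF).
set G := fset_set [set k | g k != 0].
have gG i : i \notin G -> g i = 0 by exact: laurent_out.
pose A : {fset int} := [fset (i + j)%R | i in F, j in G]%fset.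
have iA i j : i \in F -> j \in G -> i + j \in A.
  by move=> iF jG; apply/imfset2P; exists i => //; exists j.
have fgA j : j \notin A -> lmul f g j = 0.
  move=> jA /=; rewrite (lconvE _ _ fF) big_seq big1// => i iF.
  rewrite gG ?mulr0//; apply: contra jA => jG.
  by rewrite -(subrK i j) addrC; exact: iA.
rewrite -[lconv (lconv f g) h k]/(lconv (lmul f g) h k) (lconvE _ _ fgA) /=.
under [RHS]eq_bigr do rewrite (lconvE _ _ fF) mulr_suml.
rewrite exchange_big big_seq [RHS]big_seq; apply: eq_bigr => i iF.
under [RHS]eq_bigr do rewrite -mulrA.
rewrite -mulr_sumr; congr (_ * _).
rewrite -(@fsbigTE _ _ _ _ A (fun j => g (j - i) * h (k - j))); last first.
  move=> j jA; rewrite gG ?mul0r//; apply: contra jA => jG.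
  by rewrite -(subrK i j) addrC; exact: iA.
rewrite (@reindex_fsbigT _ _ _ _ _ (fun j : int => j + i)); last first.
  by exists (fun j => j - i) => j; rewrite ?addrK ?subrK.
rewrite /lconv; apply: eq_fsbigr => j _.
by rewrite addrK opprD addrA addrAC.
Qed.

Lemma lmul1l : left_id lone lmul.
Proof.
move=> f; apply: laurent_eqP => k /=.
have one0 i : i \notin [fset (0 : int)]%fset -> lone i = 0.
  by rewrite inE /= => /negPf ->.
by rewrite (lconvE _ _ one0) big_seq_fset1 /= mul1r subr0.
Qed.

Lemma lmul1r : right_id lone lmul.
Proof.
move=> f; apply: laurent_eqP => k /=; rewrite /lconv.
rewrite (fsbigTE [fset k]%fset) => [|i].
  by rewrite big_seq_fset1 subrr eqxx mulr1.
by rewrite inE subr_eq0 eq_sym => /negPf ->; rewrite mulr0.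
Qed.

Lemma lmulDl : left_distributive lmul +%R.
Proof.
move=> f g h; apply: laurent_eqP => k /=.
pose A := (fset_set [set k | f k != 0%R] `|` fset_set [set k | g k != 0%R])%fset.
have fA i : i \notin A -> f i = 0.
  by rewrite inE negb_or => /andP[/laurent_out].
have gA i : i \notin A -> g i = 0.
  by rewrite inE negb_or => /andP[_ /laurent_out].
have fgA i : i \notin A -> ladd f g i = 0.
  by move=> iA /=; rewrite fA// gA// addr0.
rewrite -[lconv (f + g) h k]/(lconv (ladd f g) h k).
rewrite (lconvE _ _ fA) (lconvE _ _ gA) (lconvE _ _ fgA) -big_split /=.
by apply: eq_bigr => i _; rewrite mulrDl.
Qed.

Lemma lmulDr : right_distributive lmul +%R.
Proof.
move=> f g h; apply: laurent_eqP => k /=.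
rewrite !(lconvE _ _ (@laurent_out f)) -big_split /=.
by apply: eq_bigr => i _; rewrite mulrDr.
Qed.

HB.instance Definition _ := GRing.Zmodule_isPzRing.Build (laurent R)
  lmulA lmul1l lmul1r lmulDl lmulDr.

Definition half (neg : bool) : {pred laurent R} := fun f =>
  `[< forall k : int, f k != 0 -> if neg then k <= 0 else 0 <= k >].

Lemma half_subring_closed neg : subring_closed (half neg).
Proof.
split=> [|f g|f g].
- apply/asboolP => k /=; case: (eqVneq k 0) => [->|_]; first by rewrite lexx if_same.
  by rewrite eqxx.
- move=> /asboolP fh /asboolP gh; apply/asboolP => k /= fgk.
  have [fk|/fh//] := eqVneq (f k) 0.
  by apply: gh; apply: contraNneq fgk => ->; rewrite fk oppr0 addr0.
- move=> /asboolP fh /asboolP gh; apply/asboolP => k /= fgk.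
  have [i fi gi] : exists2 i, f i != 0 & g (k - i) != 0.
    apply: contrapT => /forall2NP nex; move/eqP: fgk; apply.
    apply: fsbig1 => i _; case: (nex i) => /negP; rewrite negbK => /eqP ->.
      by rewrite mul0r.
    by rewrite mulr0.
  move: (fh _ fi) (gh _ gi); case: neg {fh gh} => ih kh; rewrite -(subrK i k).
    by rewrite -[leRHS]addr0 lerD.
  by rewrite -[leLHS]addr0 lerD.
Qed.

End laurent_ring.
Arguments half R neg : clear implicits.

(* R[t] for neg = false and R[t^-1] for neg = true. *)
Definition halfring (neg : bool) (R : pzRingType) : Type :=
  {f : laurent R | f \in half R neg}.
HB.instance Definition _ (R : pzRingType) (neg : bool) :=
  SubChoice.on (halfring neg R).
HB.instance Definition _ (R : pzRingType) (neg : bool) :=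
  GRing.SubChoice_isSubPzRing.Build (laurent R) (half R neg) (halfring neg R)
    (half_subring_closed R neg).

Definition half_incl (neg : bool) (R : pzRingType) :
  {rmorphism halfring neg R -> laurent R} := val.

Section laurent_map.
Context (R S : pzRingType) (phi : {rmorphism R -> S}).

Lemma lmap_finite (f : laurent R) : finite_set [set k | phi (f k) != 0].
Proof.
apply: sub_finite_set (lcoef_finite f) => k /=.
by apply: contraNneq => ->; rewrite rmorph0.
Qed.

Definition lmap (f : laurent R) : laurent S := Laurent (lmap_finite f).

Lemma lmap_zmod_morphism : zmod_morphism lmap.
Proof. by move=> f g; apply: laurent_eqP => k /=; rewrite raddfB. Qed.

Lemma lmap_monoid_morphism : monoid_morphism lmap.
Proof.
split=> [|f g]; apply: laurent_eqP => k /=; first by rewrite rmorph_nat.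
pose A := fset_set [set k | f k != 0].
have fA i : i \notin A -> f i = 0 by exact: laurent_out.
have lfA i : i \notin A -> lmap f i = 0 by move=> /fA /= ->; rewrite rmorph0.
rewrite (lconvE _ _ fA) rmorph_sum.
rewrite -[RHS]/(lconv (lmap f) (lmap g) k) (lconvE _ _ lfA).
by apply: eq_bigr => i _; rewrite rmorphM.
Qed.

HB.instance Definition _ :=
  GRing.isZmodMorphism.Build (laurent R) (laurent S) lmap lmap_zmod_morphism.
HB.instance Definition _ :=
  GRing.isMonoidMorphism.Build (laurent R) (laurent S) lmap
    lmap_monoid_morphism.

Definition laurent_map : {rmorphism laurent R -> laurent S} := lmap.

Lemma hmap_subproof neg (f : halfring neg R) : lmap (val f) \in half S neg.
Proof.
apply/asboolP => k /= fk; have /asboolP := valP f; apply.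
by apply: contraNneq fk => ->; rewrite rmorph0.
Qed.

Definition hmap neg (f : halfring neg R) : halfring neg S :=
  Sub (lmap (val f)) (hmap_subproof f).

Lemma hmap_zmod_morphism neg : zmod_morphism (@hmap neg).
Proof. by move=> f g; apply: val_inj; rewrite /= raddfB. Qed.

Lemma hmap_monoid_morphism neg : monoid_morphism (@hmap neg).
Proof.
by split=> [|f g]; apply: val_inj; rewrite /= ?rmorph1 // rmorphM.
Qed.

HB.instance Definition _ neg :=
  GRing.isZmodMorphism.Build (halfring neg R) (halfring neg S) (@hmap neg)
    (@hmap_zmod_morphism neg).
HB.instance Definition _ neg :=
  GRing.isMonoidMorphism.Build (halfring neg R) (halfring neg S) (@hmap neg)
    (@hmap_monoid_morphism neg).

Definition half_map neg : {rmorphism halfring neg R -> halfring neg S} :=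
  @hmap neg.

End laurent_map.

Section functor_on_rings.
Context (F : functor Ring Ab).

Definition robj (R : pzRingType) : zmodType := F R.
Definition rmap (R S : pzRingType) (phi : {rmorphism R -> S}) :
  {additive robj R -> robj S} := @fmap Ring Ab F R S phi.

Lemma rmap_id (R : pzRingType) : rmap (idfun : {rmorphism R -> R}) =1 id.
Proof. by move=> x; rewrite /rmap (fmap_id F (R : Ring)). Qed.

Lemma rmap_comp (R S T : pzRingType)
    (psi : {rmorphism S -> T}) (phi : {rmorphism R -> S}) x :
  rmap (psi \o phi) x = rmap psi (rmap phi x).
Proof. by rewrite /rmap (@fmap_cmp Ring Ab F R S T psi phi). Qed.

Lemma eq_rmap (R S : pzRingType) (phi psi : {rmorphism R -> S}) x :
  phi =1 psi -> rmap phi x = rmap psi x.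
Proof. by move=> /rmorphism_eqP ->. Qed.

End functor_on_rings.

(* Bass's contraction L F: the cokernel of
   F(R[t]) (+) F(R[t^-1]) -> F(R[t, t^-1]). *)
Section bass.
Context (F : functor Ring Ab).

Definition bass_relations (R : pzRingType) : set (robj F (laurent R)) :=
  [set y | exists neg x, y = rmap F (half_incl neg R) x].

Definition bass_ob (R : pzRingType) : zmodType := zquot (@bass_relations R).

Section bass_map.
Context (R S : pzRingType) (phi : {rmorphism R -> S}).

Lemma bass_relations_map x : @bass_relations R x ->
  zgen (@bass_relations S) (rmap F (laurent_map phi) x).
Proof.
move=> [neg [u ->]]; apply/asboolP; apply: sub_gen_smallest.
exists neg, (rmap F (half_map phi neg) u).
by rewrite -!rmap_comp; exact: eq_rmap.
Qed.

Definition bass_map : {additive bass_ob R -> bass_ob S} :=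
  zquot_map bass_relations_map.

Lemma bass_mapE x : bass_map (zpi (@bass_relations R) x) =
  zpi (@bass_relations S) (rmap F (laurent_map phi) x).
Proof. exact: (zquot_funE bass_relations_map). Qed.

End bass_map.

Lemma bass_map_id (R : pzRingType) :
  bass_map (idfun : {rmorphism R -> R}) = idfun.
Proof.
apply: additive_eqP => q; have [x <-] := zpi_surj q.
rewrite bass_mapE [RHS]/=; apply: congr1; rewrite -[RHS](@rmap_id F).
by apply: eq_rmap => f; exact: laurent_eqP.
Qed.

Lemma bass_map_comp (R S T : pzRingType)
    (psi : {rmorphism S -> T}) (phi : {rmorphism R -> S}) :
  bass_map (psi \o phi) = (bass_map psi \o bass_map phi).
Proof.
apply: additive_eqP => q; have [x <-] := zpi_surj q.
transitivity (bass_map psi (bass_map phi (zpi (@bass_relations R) x))) => //.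
rewrite !bass_mapE -rmap_comp; apply: congr1.
by apply: eq_rmap => f; exact: laurent_eqP.
Qed.

Definition bass : functor Ring Ab :=
  @Functor Ring Ab bass_ob (fun R S phi => bass_map phi) bass_map_id
    (fun R S T psi phi => bass_map_comp psi phi).

End bass.

(* K_{-n}, by Bass's definition of the negative K-groups. *)
Definition Kneg (n : nat) : functor Ring Ab := iter n bass K0_functor.
(* Unital associative Banach algebras, not necessarily commutative; the norm of
   the unit is not normalised, so the zero algebra is allowed. The product is
   not a pzRingType structure on V because the library has no room for a join
   of rings with normed modules. *)
HB.mixin Record isBanachAlgebra (K : numFieldType) V
    & CompleteNormedModule K V := {
  bone : V;
  bmul : V -> V -> V;
  bmulA : associative bmul;
  bmul1l : left_id bone bmul;
  bmul1r : right_id bone bmul;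
  bmulDl : left_distributive bmul +%R;
  bmulDr : right_distributive bmul +%R;
  bscaleAl : forall (k : K) (x y : V), k *: bmul x y = bmul (k *: x) y;
  bscaleAr : forall (k : K) (x y : V), k *: bmul x y = bmul x (k *: y);
  norm_bmul : forall x y : V, `|bmul x y| <= `|x| * `|y|
}.

#[short(type="banachAlgType")]
HB.structure Definition BanachAlgebra (K : numFieldType) :=
  {V of CompleteNormedModule K V & isBanachAlgebra K V}.

HB.mixin Record isCompactHausdorff S & Topological S := {
  compactum_compact : compact [set: S];
  compactum_hausdorff : hausdorff_space S
}.

#[short(type="compactumType")]
HB.structure Definition Compactum := {S of Topological S & isCompactHausdorff S}.

HB.mixin Record isExtremallyDisconnected S & Topological S := {
  open_closure : forall U : set S, open U -> open (closure U)
}.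

#[short(type="edisType")]
HB.structure Definition EDisCompactum :=
  {S of Compactum S & isExtremallyDisconnected S}.

HB.instance Definition _ := hasNbhs.Build unit principal_filter.
HB.instance Definition _ := Discrete_ofNbhs.Build unit erefl.

Lemma unit_compact : compact [set: unit].
Proof.
suff -> : [set: unit] = [set tt] by exact: compact_set1.
by apply/seteqP; split=> [[]|].
Qed.

Lemma unit_hausdorff : hausdorff_space unit.
Proof. by move=> [] []. Qed.

Lemma unit_open_closure (U : set unit) : open U -> open (closure U).
Proof. by move=> _; exact: discrete_open. Qed.

HB.instance Definition _ :=
  isCompactHausdorff.Build unit unit_compact unit_hausdorff.
HB.instance Definition _ :=
  isExtremallyDisconnected.Build unit unit_open_closure.

Definition unit_interval (R : realType) : Type := `[0 : R, 1]%classic.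
HB.instance Definition _ (R : realType) := Topological.on (unit_interval R).

Section unit_interval.
Context (R : realType).
Local Notation I := (unit_interval R).

Lemma unit_interval_val_continuous : continuous (val : I -> R).
Proof. exact: initial_continuous. Qed.

Lemma unit_interval_compact : compact [set: I].
Proof.
move=> F FF _.
have : (val @ F) `[0 : R, 1]%classic.
  by apply: (@filterS _ F _ setT) filterT => x _; exact: (@set_valP _ _ x).
have /[apply] := @segment_compact R 0 1 (val @ F).
move=> [p [/mem_set p01 pF]]; exists (exist _ p p01 : I); split => // A B FA.
case=> _ [[U oU <-] /= Up UB].
have : (val @ F) (val @` A).
  by apply: (@filterS _ F _ A) FA => x Ax; exists x.
move=> /pF /(_ (open_nbhs_nbhs (conj oU Up))) [_ [[x Ax <-] Ux]].
by exists x; split=> //; exact: UB.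
Qed.

Lemma unit_interval_hausdorff : hausdorff_space I.
Proof.
move=> p q pq; apply: val_inj; apply: Rhausdorff => A B pA qB.
have [x [Ax Bx]] := pq _ _ (unit_interval_val_continuous pA)
  (unit_interval_val_continuous qB).
by exists (val x).
Qed.

HB.instance Definition _ :=
  isCompactHausdorff.Build I unit_interval_compact unit_interval_hausdorff.

End unit_interval.

Definition Cfun (R : realType) (S : compactumType) (A : banachAlgType R) : Type :=
  continuousType S A.

Section Cfun.
Context (R : realType) (S : compactumType) (A : banachAlgType R).
HB.instance Definition _ := Choice.copy (Cfun S A) (continuousType S A).
Local Notation C := (Cfun S A).
Implicit Types f g h : Cfun S A.

Definition mkC (u : S -> A) (uc : continuous u) : C := mkcts uc.

Lemma Cfun_continuous f : continuous f.
Proof. exact: cts_fun. Qed.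

Lemma Cfun_eqP f g : f =1 g -> f = g.
Proof. by move=> fg; apply/continuousEP. Qed.

Lemma bmul_continuous (u v : S -> A) :
  continuous u -> continuous v -> continuous (fun s => bmul (u s) (v s)).
Proof.
move=> uc vc s; apply/cvgrPdistC_le => e e0.
have bmulNl (x y : A) : bmul (- x) y = - bmul x y.
  by rewrite -scaleN1r -bscaleAl scaleN1r.
have bmulNr (x y : A) : bmul x (- y) = - bmul x y.
  by rewrite -scaleN1r -bscaleAr scaleN1r.
pose M := `|u s| + 1.
pose N := `|v s| + 1.
have M0 : 0 < M by rewrite ltr_wpDl.
have N0 : 0 < N by rewrite ltr_wpDl.
near=> t.
have -> : bmul (u t) (v t) - bmul (u s) (v s) =
    bmul (u t) (v t - v s) + bmul (u t - u s) (v s).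
  by rewrite bmulDl bmulDr bmulNl bmulNr addrA subrK.
rewrite (le_trans (ler_normD _ _))// [leRHS](splitr e) lerD//.
  rewrite (le_trans (norm_bmul _ _))//.
  have utM : `|u t| <= M.
    by near: t; apply: (cvgr_norm_le _ (uc s)); rewrite ltrDl.
  rewrite (le_trans (ler_wpM2r _ utM))// mulrC -ler_pdivlMr//.
  near: t; apply: cvgr_distC_le; [exact: vc|by rewrite !divr_gt0].
rewrite (le_trans (norm_bmul _ _))//.
have vsN : `|v s| <= N by rewrite lerDl.
rewrite (le_trans (ler_wpM2l _ vsN))// -ler_pdivlMr//.
near: t; apply: cvgr_distC_le; [exact: uc|by rewrite !divr_gt0].
Unshelve. all: by end_near. Qed.

Lemma cscale_continuous (k : R) (u : S -> A) :
  continuous u -> continuous (fun s => k *: u s).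
Proof. by move=> uc s; apply: cvgZl_tmp; exact: uc. Qed.

Definition czero : C := mkC (@cst_continuous S A 0).
Definition cone : C := mkC (@cst_continuous S A bone).
Definition copp f : C := mkC (fun s => continuousN (@Cfun_continuous f s)).
Definition cadd f g : C :=
  mkC (fun s => continuousD (@Cfun_continuous f s) (@Cfun_continuous g s)).
Definition cscale (k : R) f : C :=
  mkC (@cscale_continuous k _ (@Cfun_continuous f)).
Definition cmul f g : C :=
  mkC (bmul_continuous (@Cfun_continuous f) (@Cfun_continuous g)).

Lemma caddA : associative cadd.
Proof. by move=> f g h; apply: Cfun_eqP => s; exact: addrA. Qed.
Lemma caddC : commutative cadd.
Proof. by move=> f g; apply: Cfun_eqP => s; exact: addrC. Qed.
Lemma cadd0 : left_id czero cadd.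
Proof. by move=> f; apply: Cfun_eqP => s; exact: add0r. Qed.
Lemma caddN : left_inverse czero copp cadd.
Proof. by move=> f; apply: Cfun_eqP => s; exact: addNr. Qed.

HB.instance Definition _ := GRing.isZmodule.Build C caddA caddC cadd0 caddN.

Lemma cscaleA (a b : R) f : cscale a (cscale b f) = cscale (a * b) f.
Proof. by apply: Cfun_eqP => s; exact: scalerA. Qed.
Lemma cscale1 : left_id 1 cscale.
Proof. by move=> f; apply: Cfun_eqP => s; exact: scale1r. Qed.
Lemma cscaleDr : right_distributive cscale +%R.
Proof. by move=> k f g; apply: Cfun_eqP => s; exact: scalerDr. Qed.
Lemma cscaleDl f : {morph cscale^~ f : a b / a + b}.
Proof. by move=> a b; apply: Cfun_eqP => s; exact: scalerDl. Qed.

HB.instance Definition _ := GRing.Zmodule_isLmodule.Build R C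
  cscaleA cscale1 cscaleDr cscaleDl.

Lemma cmulA : associative cmul.
Proof. by move=> f g h; apply: Cfun_eqP => s; exact: bmulA. Qed.
Lemma cmul1l : left_id cone cmul.
Proof. by move=> f; apply: Cfun_eqP => s; exact: bmul1l. Qed.
Lemma cmul1r : right_id cone cmul.
Proof. by move=> f; apply: Cfun_eqP => s; exact: bmul1r. Qed.
Lemma cmulDl : left_distributive cmul +%R.
Proof. by move=> f g h; apply: Cfun_eqP => s; exact: bmulDl. Qed.
Lemma cmulDr : right_distributive cmul +%R.
Proof. by move=> f g h; apply: Cfun_eqP => s; exact: bmulDr. Qed.

HB.instance Definition _ :=
  GRing.Zmodule_isPzRing.Build C cmulA cmul1l cmul1r cmulDl cmulDr.

Definition supnorm f : R := sup (range (fun s => `|f s|)).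

Lemma supnorm_has_ubound f : has_ubound (range (fun s => `|f s|)).
Proof.
have fT : compact (f @` [set: S]).
  apply: continuous_compact; last exact: compactum_compact.
  exact/continuous_subspaceT/Cfun_continuous.
have [M [_ MP]] := compact_bounded fT.
exists (M + 1) => _ [s _ <-].
by apply: (MP (M + 1)); [rewrite ltrDl | exists s].
Qed.

Lemma supnorm_ge f s : `|f s| <= supnorm f.
Proof. by apply: ub_le_sup; [exact: supnorm_has_ubound | exists s]. Qed.

Lemma supnorm_le f (c : R) : 0 <= c -> (forall s, `|f s| <= c) -> supnorm f <= c.
Proof.
move=> c0 fc; rewrite /supnorm.
have [->|/set0P ne] := eqVneq (range (fun s => `|f s|)) set0.
  by rewrite sup0.
by apply: ge_sup => // _ [s _ <-].
Qed.

Lemma supnorm_ge0 f : 0 <= supnorm f.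
Proof.
have [s|noS] := pselect (exists s : S, True).
  by case: s => s _; exact: le_trans (supnorm_ge f s).
rewrite /supnorm; have -> : range (fun s => `|f s|) = set0; last by rewrite sup0.
by rewrite -subset0 => t [s _ _]; apply: noS; exists s.
Qed.

Lemma supnormD f g : supnorm (f + g) <= supnorm f + supnorm g.
Proof.
apply: supnorm_le => [|s]; first by rewrite addr_ge0// supnorm_ge0.
by rewrite (le_trans (ler_normD _ _))// lerD// supnorm_ge.
Qed.

Lemma supnormZ_le (k : R) f : supnorm (k *: f) <= `|k| * supnorm f.
Proof.
apply: supnorm_le => [|s]; first by rewrite mulr_ge0// supnorm_ge0.
by rewrite normrZ ler_wpM2l// supnorm_ge.
Qed.

Lemma supnormZ (k : R) f : supnorm (k *: f) = `|k| * supnorm f.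
Proof.
apply/eqP; rewrite eq_le supnormZ_le /=.
have [->|k0] := eqVneq k 0; first by rewrite normr0 mul0r supnorm_ge0.
rewrite -ler_pdivlMl ?normr_gt0// -normfV.
by have := supnormZ_le k^-1 (k *: f); rewrite scalerA mulVf// scale1r.
Qed.

Lemma supnorm0_eq0 f : supnorm f = 0 -> f = 0.
Proof.
move=> f0; apply: Cfun_eqP => s; apply/eqP.
by rewrite -normr_le0 -f0 supnorm_ge.
Qed.

HB.instance Definition _ :=
  Lmodule_isNormed.Build R C supnormD supnormZ supnorm0_eq0.

Lemma Cfun_normE f : `|f| = supnorm f.
Proof. by []. Qed.

Lemma Cfun_complete (F : set_system C) : ProperFilter F -> cauchy F -> cvg F.
Proof.
move=> FF Fc.
have near_bound (e : R) : 0 < e -> exists f0 : C, \forall f \near F, `|f - f0| <= e.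
  move=> e0; have /cauchyP /(_ e e0) [f0 f0e] := Fc; exists f0.
  near=> f; rewrite distrC ltW//; near: f.
  by move: f0e; rewrite -ball_normE.
have cvgx s : cvg ((fun f : C => f s) @ F).
  apply: cauchy_cvg; apply/cauchyP => e e0.
  have e2 : 0 < e / 2 by rewrite divr_gt0.
  have [f0 f0e] := near_bound _ e2.
  exists (f0 s); suff: F (fun f : C => ball (f0 s) e (f s)) by [].
  apply: (@filterS C F _ _ _ _ f0e) => f ff0.
  rewrite /= -ball_normE /= distrC.
  rewrite (@le_lt_trans _ _ (e / 2))//; last first.
    by rewrite ltr_pdivrMr// mulr_natr mulr2n ltrDl.
  by rewrite (le_trans (supnorm_ge (f - f0) s)).
pose g (s : S) : A := lim ((fun f : C => f s) @ F).
have gle (f0 : C) e : (\forall f \near F, `|f - f0| <= e) ->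
    forall s, `|g s - f0 s| <= e.
  move=> f0e s.
  have gs : (fun f : C => `|f s - f0 s|) @ F --> `|g s - f0 s|.
    by apply: cvg_norm; apply: cvgB; [exact: cvgx | exact: cvg_cst].
  rewrite -(cvg_lim _ gs)//; apply: limr_le; first by apply/cvg_ex; eexists; exact: gs.
  near=> f; rewrite (le_trans (supnorm_ge (f - f0) s))//; near: f; exact: f0e.
have gc : continuous g.
  move=> s; apply/cvgrPdistC_le => e e0.
  have e3 : 0 < e / 3 by rewrite divr_gt0.
  have [f0 f0e] := near_bound _ e3.
  near=> t.
  rewrite (_ : g t - g s = (g t - f0 t) + (f0 t - f0 s) - (g s - f0 s)); last first.
    by rewrite addrA subrK opprB addrA subrK.
  rewrite (_ : e = e / 3 + e / 3 + e / 3); last by rewrite -!mulrDl; field.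
  rewrite (le_trans (ler_normB _ _))// lerD//; last exact: gle.
  rewrite (le_trans (ler_normD _ _))// lerD//; first exact: gle.
  by near: t; apply: cvgr_distC_le; [exact: Cfun_continuous|].
apply/cvg_ex; exists (mkC gc); apply/cvgrPdistC_le => e e0.
have e2 : 0 < e / 2 by rewrite divr_gt0.
have [f0 f0e] := near_bound _ e2.
near=> f.
rewrite (_ : f - mkC gc = (f - f0) - (mkC gc - f0)); last first.
  by rewrite opprB addrA subrK.
rewrite (le_trans (ler_normB _ _))// [leRHS](splitr e) lerD//; first by near: f.
by apply: supnorm_le => [|s]; [exact: ltW | exact: gle].
Unshelve. all: by end_near. Qed.

HB.instance Definition _ := Uniform_isComplete.Build C Cfun_complete.

Lemma cscaleAl (k : R) f g : k *: cmul f g = cmul (k *: f) g.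
Proof. by apply: Cfun_eqP => s; exact: bscaleAl. Qed.
Lemma cscaleAr (k : R) f g : k *: cmul f g = cmul f (k *: g).
Proof. by apply: Cfun_eqP => s; exact: bscaleAr. Qed.
Lemma supnormM f g : `|cmul f g| <= `|f| * `|g|.
Proof.
apply: supnorm_le => [|s]; first by rewrite mulr_ge0.
by rewrite (le_trans (norm_bmul _ _))// ler_pM// supnorm_ge.
Qed.

HB.instance Definition _ := isBanachAlgebra.Build R C cmulA cmul1l cmul1r
  cmulDl cmulDr cscaleAl cscaleAr supnormM.

End Cfun.

Definition EDis : category.
Proof.
refine (@Category edisType (fun S T => continuousType S T) (fun S => idfun)
  (fun S T U g f => g \o f) _ _ _); by move=> *; apply/continuousEP.
Defined.

Section Cfun_functor.
Context (R : realType).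

Section pullback.
Context (A : banachAlgType R) (S T : compactumType) (u : continuousType S T).

Definition Cfun_pull (f : Cfun T A) : Cfun S A := (f : continuousType T A) \o u.

Lemma Cfun_pull_zmod_morphism : zmod_morphism Cfun_pull.
Proof. by move=> f g; exact: Cfun_eqP. Qed.
Lemma Cfun_pull_monoid_morphism : monoid_morphism Cfun_pull.
Proof. by split=> [|f g]; exact: Cfun_eqP. Qed.

HB.instance Definition _ := GRing.isZmodMorphism.Build (Cfun T A) (Cfun S A)
  Cfun_pull Cfun_pull_zmod_morphism.
HB.instance Definition _ := GRing.isMonoidMorphism.Build (Cfun T A) (Cfun S A)
  Cfun_pull Cfun_pull_monoid_morphism.

Definition Cfun_map : {rmorphism Cfun T A -> Cfun S A} := Cfun_pull.

End pullback.

Definition Cfun_functor (A : banachAlgType R) : functor (opcat EDis) Ring.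
Proof.
refine (@Functor (opcat EDis) Ring (fun S : edisType => Cfun S A : pzRingType)
  (fun T S (u : continuousType S T) => Cfun_map A u) _ _).
- by move=> S; apply: rmorphism_eqP => f; exact: Cfun_eqP.
- by move=> S T U u v; apply: rmorphism_eqP => f; exact: Cfun_eqP.
Defined.

Section constants.
Context (K : compactumType) (A : banachAlgType R).

Definition Cconst (a : A) : Cfun K A := (cst a : continuousType K A).

Lemma Cconst_continuous : continuous Cconst.
Proof.
move=> a; apply/cvgrPdist_le => e e0; near=> b.
have ab : `|a - b| <= e by near: b; apply: cvgr_dist_le => //; exact: cvg_id.
by apply: supnorm_le => [|s]; [exact: ltW | exact: ab].
Unshelve. all: by end_near. Qed.

Section postcomposition.
Context (S : compactumType).

Definition Cpost (f : Cfun S A) : Cfun S (Cfun K A) :=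
  mkcts (fun s => continuous_comp (@Cfun_continuous _ _ _ f s)
                    (@Cconst_continuous (f s))).

Lemma Cpost_zmod_morphism : zmod_morphism Cpost.
Proof. by move=> f g; apply: Cfun_eqP => s; exact: Cfun_eqP. Qed.
Lemma Cpost_monoid_morphism : monoid_morphism Cpost.
Proof. by split=> [|f g]; apply: Cfun_eqP => s; exact: Cfun_eqP. Qed.

HB.instance Definition _ := GRing.isZmodMorphism.Build (Cfun S A)
  (Cfun S (Cfun K A)) Cpost Cpost_zmod_morphism.
HB.instance Definition _ := GRing.isMonoidMorphism.Build (Cfun S A)
  (Cfun S (Cfun K A)) Cpost Cpost_monoid_morphism.

Definition Cpost_map : {rmorphism Cfun S A -> Cfun S (Cfun K A)} := Cpost.

End postcomposition.

Definition Cfun_const :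
  nattrans (Cfun_functor A) (Cfun_functor (Cfun K A)).
Proof.
refine (@NatTrans (opcat EDis) Ring (Cfun_functor A) (Cfun_functor (Cfun K A))
  (fun S : edisType => Cpost_map S) _).
by move=> S T u; apply: rmorphism_eqP => f; exact: Cfun_eqP.
Defined.

End constants.

(* The condensed abelian group S |-> K_{-n}(C(S; A)). *)
Definition Kcond (n : nat) (A : banachAlgType R) : functor (opcat EDis) Ab :=
  fcmp (Kneg n) (Cfun_functor A).

(* Induced by the inclusion of the constants A -> C(K; A). *)
Definition Kcond_const (n : nat) (K : compactumType) (A : banachAlgType R) :
    nattrans (Kcond n A) (Kcond n (Cfun K A)) :=
  whisker (Kneg n) (Cfun_const K A).

End Cfun_functor.

(* The extremally disconnected compacta of cardinality < aleph_0. *)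
Definition finite_EDis (S : EDis) : Prop := finite_set [set: (S : edisType)].
Definition FinEDis : category := fullsub finite_EDis.

Section pull_fun.
Context (M : zmodType) (S T : Type) (u : S -> T).
Definition pull_fun (f : T -> M) : S -> M := f \o u.
Lemma pull_fun_zmod_morphism : zmod_morphism pull_fun.
Proof. by move=> f g; exact/funext. Qed.
HB.instance Definition _ := GRing.isZmodMorphism.Build (T -> M) (S -> M)
  pull_fun pull_fun_zmod_morphism.
Definition fun_map : {additive (T -> M) -> (S -> M)} := pull_fun.
End pull_fun.

(* The aleph_0-condensed abelian group T |-> M^T attached to M. *)
Definition power_functor (M : zmodType) : functor (opcat FinEDis) Ab.
Proof.
refine (@Functor (opcat FinEDis) Ab
  (fun S : FinEDis => ((sval S : edisType) -> M) : zmodType)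
  (fun T S (u : continuousType _ _) => fun_map M u) _ _);
by move=> *; apply: additive_eqP.
Defined.

(* Left Kan extension along EDis_{aleph_0} -> EDis is the left adjoint of
   restriction, so this is the essential image of the abelian groups M. *)
Definition discrete_condensed (F : functor (opcat EDis) Ab) : Prop :=
  exists (M : zmodType) (eta : nattrans (power_functor M)
                                 (fcmp F (op_incl finite_EDis))),
    is_left_kan_extension eta.

Definition is_iso (C : category) (x y : C) (f : hom x y) : Prop :=
  exists g : hom y x, cmp g f = idm x /\ cmp f g = idm y.

(* Main.v *)
From HB Require Import structures.
From mathcomp Require Import all_boot all_order all_algebra.
From mathcomp Require Import all_classical all_reals all_analysis.
Require Import Defs.

(** The unit interval I contracts to a point through the maps t |-> u t, with u
    in I. They act on C = C(I; A), hence on K(C) for every functor K from rings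
    to abelian groups; u = 1 acts as the identity, and u = 0 acts as evaluation
    at 0 followed by the inclusion of the constants. Evaluation at 0 is always a
    left inverse of the map induced by the constants, so this map is an
    isomorphism as soon as the action of u on each z in K(C) does not depend
    on u.

    Discreteness of the condensed group S |-> K(C(S; C)) makes the action
    independent of u. For an extremally disconnected S and a continuous
    p : S -> I, the maps t |-> p(s) t assemble into one ring homomorphism
    C -> C(S; C) ([sweep]), so that s |-> (p(s) acting on z) is the family of
    values at the points of S of one class in K(C(S; C)). Such a family is
    locally constant ([discrete_point_values_loc_const]). Take for S the
    ultrafilters on I, that is, the Stone-Cech compactification of I as a
    discrete set, and for p the limit map: a function on I whose composite with
    p is locally constant is itself locally constant ([loc_const_ultra_lim]),
    hence constant since I is connected.

    Discreteness is used only through the uniqueness half of the universal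
    property of Kan extensions. Functions from S to F(pt) modulo the locally
    constant ones form a functor of S, to which F maps by sending a section to
    its values at points. On finite S every function is locally constant, so
    this transformation and the zero transformation agree there, and a
    transformation out of a Kan extension is determined by its restriction:
    they agree everywhere. *)

Set Implicit Arguments.
Unset Strict Implicit.
Unset Printing Implicit Defensive.

Import Order.TTheory GRing.Theory Num.Theory numFieldNormedType.Exports.

Local Open Scope classical_set_scope.
Local Open Scope ring_scope.

(** * The Stone-Cech compactification of a discrete set *)

Record stone_cech (X : Type) := StoneCech {
  ufilter :> set X -> Prop;
  ufilter_ultra : UltraFilter (ufilter : set_system X)
}.

#[local] Existing Instance ufilter_ultra.

HB.instance Definition _ (X : Type) := gen_eqMixin (stone_cech X).
HB.instance Definition _ (X : Type) := gen_choiceMixin (stone_cech X).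

Lemma stone_cech_eqP (X : Type) (F G : stone_cech X) :
  ufilter F = ufilter G -> F = G.
Proof.
by case: F G => F FU [G GU] /= FG; subst G; rewrite (Prop_irrelevance FU GU).
Qed.

Lemma prime_filter_ultra (T : Type) (F : set_system T) : ProperFilter F ->
  (forall A, F A \/ F (~` A)) -> UltraFilter F.
Proof.
move=> FF Fdich; split=> // G GF FG; apply/seteqP; split=> // A GA.
have [//|/FG GnA] := Fdich A.
by case: (filter_ex (filterI GA GnA)) => x [].
Qed.

Section stone_cech_topology.
Context (X : Type).
Implicit Types (F G : stone_cech X) (A : set X).

Definition clopen_with A : set (stone_cech X) := [set F : stone_cech X | F A].

Definition stone_cech_nbhs F : set_system (stone_cech X) :=
  [set U | exists2 A, F A & clopen_with A `<=` U].

HB.instance Definition _ := hasNbhs.Build (stone_cech X) stone_cech_nbhs.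

Lemma stone_cech_nbhs_filter F : ProperFilter (nbhs F).
Proof.
apply: Build_ProperFilter_ex => [U [A FA AU]|]; first by exists F; exact: AU.
split=> [|U V [A FA AU] [B FB BV]|U V UV [A FA AU]].
- by exists setT => //; exact: filterT.
- exists (A `&` B); first exact: filterI.
  by move=> G GAB; split; [apply: AU | apply: BV]; apply: filterS GAB => x [].
- by exists A => //; exact: subset_trans UV.
Qed.

Lemma stone_cech_nbhs_singleton F (U : set (stone_cech X)) : nbhs F U -> U F.
Proof. by move=> [A FA]; exact. Qed.

Lemma stone_cech_nbhs_nbhs F (U : set (stone_cech X)) :
  nbhs F U -> nbhs F (nbhs^~ U).
Proof. by move=> [A FA AU]; exists A => // G GA; exists A. Qed.

HB.instance Definition _ := Nbhs_isNbhsTopological.Build (stone_cech X)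
  stone_cech_nbhs_filter stone_cech_nbhs_singleton stone_cech_nbhs_nbhs.

Lemma clopen_with_open A : open (clopen_with A).
Proof. by rewrite openE => F FA; exists A. Qed.

Lemma clopen_withC A : ~` clopen_with A = clopen_with (~` A).
Proof.
apply/seteqP; split=> F /= FA.
  by have [] := in_ultra_setVsetC A (ufilter_ultra F).
by move=> /(filterI FA) FAA; have [x []] := filter_ex FAA.
Qed.

Lemma clopen_with_closed A : closed (clopen_with A).
Proof.
by rewrite -[clopen_with A]setCK closedC clopen_withC; exact: clopen_with_open.
Qed.

Definition principal_ultra (x : X) : stone_cech X :=
  StoneCech (principal_filter_ultra x).

(** An ultrafilter [Phi] of ultrafilters converges to its flattening, the
    family of the sets [A] such that [Phi]-almost every [G] contains [A]. *)
Lemma stone_cech_compact : compact [set: stone_cech X].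
Proof.
rewrite compact_ultra => /= Phi PhiU _.
pose F : set_system X := [set A | Phi (clopen_with A)].
have FF : ProperFilter F.
  apply: Build_ProperFilter_ex => [A PhiA|].
    by have [G GA] := filter_ex (PhiA : Phi (clopen_with A));
      exact: filter_ex GA.
  split=> [|A B FA FB|A B AB].
  - by apply: filterS (@filterT _ Phi _) => G _; exact: filterT.
  - by apply: filterS (@filterI _ Phi _ _ _ FA FB) => G [GA GB]; exact: filterI.
  - by apply: (@filterS _ Phi) => G; exact: filterS.
have FU : UltraFilter F.
  apply: prime_filter_ultra => A; rewrite /F /= -clopen_withC.
  exact: in_ultra_setVsetC.
exists (StoneCech FU); split=> // U [A FA AU].
exact: filterS AU FA.
Qed.

Lemma stone_cech_hausdorff : hausdorff_space (stone_cech X).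
Proof.
move=> F G FG; apply: stone_cech_eqP; apply/seteqP.
have sub (F' G' : stone_cech X) :
    cluster (nbhs F') G' -> ufilter F' `<=` ufilter G'.
  move=> clu A FA; apply: contrapT => GA.
  have {}GA : G' (~` A) by have [] := in_ultra_setVsetC A (ufilter_ultra G').
  have [] := clu (clopen_with A) (clopen_with (~` A)).
  - by exists A.
  - by exists (~` A).
  - by move=> H [HA]; rewrite -clopen_withC.
split; apply: sub => //.
by move=> U V FU GV; have [H []] := FG V U GV FU; exists H.
Qed.

(** The principal ultrafilters are dense, so the closure of an open set [U]
    only depends on which of them it contains: it is the basic clopen set of
    these points. *)
Lemma stone_cech_open_closure (U : set (stone_cech X)) :
  open U -> open (closure U).
Proof.
move=> Uo; suff -> : closure U = clopen_with [set x | U (principal_ultra x)].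
  exact: clopen_with_open.
apply/seteqP; split=> F.
  rewrite closureE; apply; split; first exact: clopen_with_closed.
  move=> G UG; have [A GA AU] : nbhs G U by exact: open_nbhs_nbhs.
  by apply: filterS GA => x Ax; apply/AU/principal_filterP.
move=> FU V [A FA AV]; have [x [Ux Ax]] := filter_ex (filterI FU FA).
by exists (principal_ultra x); split=> //; apply/AV/principal_filterP.
Qed.

HB.instance Definition _ :=
  isCompactHausdorff.Build (stone_cech X)
    stone_cech_compact stone_cech_hausdorff.
HB.instance Definition _ :=
  isExtremallyDisconnected.Build (stone_cech X) stone_cech_open_closure.

End stone_cech_topology.

Section ultra_lim.
Context (K : compactumType).

Lemma stone_cech_cvg_ex (F : stone_cech K) :
  exists x : K, (ufilter F : set_system K) --> x.
Proof.
have := @compactum_compact K; rewrite compact_ultra.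
by move=> /(_ _ (ufilter_ultra F) filterT)[x [_ ?]]; exists x.
Qed.

Definition ultra_lim (F : stone_cech K) : K :=
  projT1 (cid (stone_cech_cvg_ex F)).

Lemma ultra_limP (F : stone_cech K) :
  (ufilter F : set_system K) --> ultra_lim F.
Proof. exact: projT2 (cid (stone_cech_cvg_ex F)). Qed.

Lemma ultra_lim_unique (F : stone_cech K) x :
  (ufilter F : set_system K) --> x -> ultra_lim F = x.
Proof.
move=> Fx; apply: (@cvg_unique _ (@compactum_hausdorff K) (ufilter F)) => //.
exact: ultra_limP.
Qed.

Lemma ultra_lim_pure x : ultra_lim (principal_ultra x) = x.
Proof.
by apply: ultra_lim_unique => U /nbhs_singleton Ux; exact/principal_filterP.
Qed.

Lemma ultra_lim_continuous : continuous ultra_lim.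
Proof.
move=> F U /=.
have Kreg := @compact_regular K _ _ (@compactum_hausdorff K).
move=> /(Kreg _ _ (@compactum_compact K) filterT)[V FV VU].
exists V; first exact: ultra_limP.
move=> G GV; apply: VU => W GW.
have [x []] := filter_ex (filterI GV (ultra_limP GW)).
by exists x.
Qed.

(** Were [phi] to differ from [phi x] at points arbitrarily close to [x], some
    ultrafilter converging to [x] would contain the set of these points. But
    [phi \o ultra_lim] is constant on the ultrafilters that contain some member
    [A] of it, among them the principal ones at the points of [A]. *)
Lemma loc_const_ultra_lim (Z : Type) (phi : K -> Z) :
  (forall F : stone_cech K,
    \forall G \near F, phi (ultra_lim G) = phi (ultra_lim F)) ->
  forall x, \forall y \near x, phi y = phi x.
Proof.
move=> phil x; apply: contrapT => nphi.
pose D := [set y | phi y <> phi x].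
have PF : ProperFilter (within D (nbhs x)).
  apply: Build_ProperFilter_ex => U xU; apply: contrapT => nU; apply: nphi.
  suff : nbhs x (fun y => phi y = phi x) by [].
  apply: (@filterS _ (nbhs x) _ _ _ _ xU) => y yU; apply: contrapT => Dy.
  by apply: nU; exists y; exact: yU.
have [F [FU xF]] := ultraFilterLemma PF.
have Fx : ultra_lim (StoneCech FU) = x.
  apply: ultra_lim_unique => U xU; apply: xF.
  by apply: filterS xU => y Uy _.
have FD : F D by apply: xF; exact: withinT.
have [A FA AP] :
    stone_cech_nbhs (StoneCech FU) (fun G => phi (ultra_lim G) = phi x).
  by have := phil (StoneCech FU); rewrite Fx.
have [y [Ay Dy]] := filter_ex (filterI FA FD).
by apply: Dy; rewrite -(ultra_lim_pure y); apply/AP/principal_filterP.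
Qed.

End ultra_lim.

(** * Sections of discrete condensed groups are locally constant *)

Lemma zgen_subgroup (V : zmodType) (M : set V) x :
  subgroup M -> zgen M x -> M x.
Proof. by move=> MP /asboolP /(_ M); apply; split. Qed.

Lemma zpi_eq0 (V : zmodType) (M : set V) x :
  subgroup M -> zpi M x = 0 <-> M x.
Proof.
move=> MP; rewrite -(raddf0 (zpi M)); split=> [/zpi_eq|Mx].
  by rewrite subr0; exact: zgen_subgroup.
by apply/zpi_eq; rewrite subr0; apply/asboolP; exact: sub_gen_smallest.
Qed.

Section loc_const.
Context (N : zmodType).

Definition loc_const (S : topologicalType) : set (S -> N) :=
  [set f : S -> N | forall s : S, \forall t \near s, f t = f s].

Lemma loc_const_subgroup (S : topologicalType) : subgroup (@loc_const S).
Proof.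
split=> [s|f g fl gl s]; first exact: nearW.
by near=> t; rewrite /= !fctE (near (fl s) t) ?(near (gl s) t).
Unshelve. all: by end_near. Qed.

Lemma loc_const_pull (S T : edisType) (u : continuousType S T) (f : T -> N) :
  loc_const f -> zgen (@loc_const S) (fun_map N u f).
Proof.
move=> fl; apply/asboolP; apply: sub_gen_smallest => s.
exact: (@cts_fun _ _ u s _ (fl (u s))).
Qed.

Section pull_mod.
Context (S T : edisType) (u : continuousType S T).

Definition pull_mod :
    {additive zquot (@loc_const T) -> zquot (@loc_const S)} :=
  zquot_map (@loc_const_pull S T u).

Lemma pull_modE f : pull_mod (zpi (@loc_const T) f) =
  zpi (@loc_const S) (f \o u).
Proof. exact: (zquot_funE (@loc_const_pull S T u)). Qed.

End pull_mod.

(** The receptacle that detects local constancy: a section of a condensed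
    group maps to zero in it exactly when its values at points are locally
    constant. *)
Definition fun_mod_loc_const : functor (opcat EDis) Ab.
Proof.
refine (@Functor (opcat EDis) Ab
  (fun S : edisType => zquot (@loc_const S))
  (fun T S (u : continuousType S T) => pull_mod u) _ _).
- move=> S; apply: additive_eqP => q; have [f <-] := zpi_surj q.
  exact: pull_modE.
- move=> S T U u v; apply: additive_eqP => q; have [f <-] := zpi_surj q.
  transitivity (pull_mod u (pull_mod v (zpi (@loc_const (S : edisType)) f)))
    => //.
  by rewrite !pull_modE.
Defined.

End loc_const.

Definition point (S : edisType) (s : S) :
    @hom (opcat EDis) S (unit : edisType) :=
  (cst s : continuousType unit S).

Section zero_nattrans.
Context (C : category) (F G : functor C Ab).

Lemma zero_natural (x y : C) (u : hom x y) :
  cmp (\0 : @hom Ab (F y) (G y)) (fmap F u) =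
  cmp (fmap G u) (\0 : @hom Ab (F x) (G x)).
Proof. by apply: additive_eqP => z /=; rewrite raddf0. Qed.

Definition zero_nattrans : nattrans F G := NatTrans zero_natural.

End zero_nattrans.

Section point_values.
Context (F : functor (opcat EDis) Ab).
Local Notation N := (F (unit : edisType) : zmodType).

Definition point_values (S : edisType) (y : (F S : zmodType)) : S -> N :=
  fun s => fmap F (point s) y.

Lemma point_values_zmod_morphism (S : edisType) :
  zmod_morphism (@point_values S).
Proof. by move=> x y; apply/funext => s; rewrite /point_values raddfB. Qed.

HB.instance Definition _ (S : edisType) := GRing.isZmodMorphism.Build
  (F S) (S -> N) (@point_values S) (@point_values_zmod_morphism S).

Lemma point_values_natural (S T : edisType) (u : continuousType S T)
    (y : (F T : zmodType)) :
  point_values (@fmap _ _ F T S u y) = point_values y \o u.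
Proof.
apply/funext => s; rewrite /point_values /=.
have /(congr1 (fun h : {additive _ -> _} => h y)) :=
  @fmap_cmp _ _ F T S (unit : edisType) (point s) u.
move=> /= <-; congr (fmap F _ y); exact/continuousEP.
Qed.

Lemma point_values_mod_loc_const_natural (S T : opcat EDis) (u : hom S T) :
  cmp (zpi (@loc_const N (T : edisType)) \o @point_values T
        : @hom Ab _ (fun_mod_loc_const N T)) (fmap F u) =
  cmp (fmap (fun_mod_loc_const N) u)
    (zpi (@loc_const N (S : edisType)) \o @point_values S : @hom Ab _ _).
Proof.
apply: additive_eqP => y /=.
rewrite (@point_values_natural T S u y); symmetry; exact: pull_modE.
Qed.

Definition point_values_mod_loc_const : nattrans F (fun_mod_loc_const N) :=
  NatTrans point_values_mod_loc_const_natural.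

End point_values.

(** A finite compactum is discrete, because its finite subsets are closed. *)
Lemma finite_loc_const (N : zmodType) (S : edisType) (f : S -> N) :
  finite_set [set: S] -> loc_const f.
Proof.
move=> Sfin s; suff so : open [set s].
  by apply: filterS (open_nbhs_nbhs (conj so erefl)) => t ->.
rewrite -[[set s]]setCK openC.
have Sacc := hausdorff_accessible (@compactum_hausdorff S).
by move/accessible_finite_set_closed: Sacc; apply; apply: sub_finite_set Sfin.
Qed.

(** The transformation [point_values_mod_loc_const] and the zero transformation
    have the same restriction to finite [S], hence coincide by the uniqueness in
    the universal property of the Kan extension. *)
Lemma discrete_point_values_loc_const (F : functor (opcat EDis) Ab)
    (S : edisType) (y : (F S : zmodType)) :
  discrete_condensed F -> loc_const (point_values y).
Proof.
move=> [M [eta kan]]; pose G := fun_mod_loc_const (F (unit : edisType)).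
have [b [_ buniq]] := kan G (zero_nattrans _ _).
have bE : point_values_mod_loc_const F = zero_nattrans F G.
  rewrite -(buniq (point_values_mod_loc_const F)).
    rewrite (buniq (zero_nattrans F G)) //.
    by move=> T; apply: additive_eqP.
  move=> T; apply: additive_eqP => z /=.
  apply/zpi_eq0; first exact: loc_const_subgroup.
  exact: finite_loc_const (svalP T).
apply: (iffLR (zpi_eq0 (point_values y) (@loc_const_subgroup _ S))).
have := congr1 (fun t : nattrans F G => (t S : {additive _ -> _}) y) bE.
exact.
Qed.

(** * The contraction of the unit interval *)

Section interval.
Context (R : realType).
Local Notation I := (unit_interval R).

Lemma unit_interval_itv (u : I) : 0 <= val u <= 1.
Proof. by have := set_valP u; rewrite /= in_itv. Qed.

Lemma continuous_to_unit_interval (T : topologicalType) (f : T -> I) :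
  continuous (val \o f) -> continuous f.
Proof. exact: continuous_comp_initial. Qed.

Lemma clamp_subproof (r : R) : Num.max 0 (Num.min 1 r) \in `[0 : R, 1]%classic.
Proof.
by rewrite inE /= in_itv /= le_max lexx /= ge_max ler01 ge_min lexx.
Qed.

(** A continuous retraction of the line onto the interval, through which the
    connectedness of the interval reduces to that of the line. *)
Definition clamp (r : R) : I :=
  exist (fun x => x \in `[0 : R, 1]%classic) _ (clamp_subproof r).

Lemma clamp_continuous : continuous clamp.
Proof.
apply: continuous_to_unit_interval => r.
apply: continuous_max; first exact: cvg_cst.
by apply: continuous_min; [exact: cvg_cst | exact: cvg_id].
Qed.

Lemma clampK (u : I) : clamp (val u) = u.
Proof.
apply: val_inj => /=; have /andP[u0 u1] := unit_interval_itv u.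
by rewrite (min_idPr u1) (max_idPr u0).
Qed.

Lemma loc_const_connected (T : topologicalType) (Z : Type) (phi : T -> Z) :
  connected [set: T] -> (forall x, \forall y \near x, phi y = phi x) ->
  forall x y, phi x = phi y.
Proof.
move=> Tconn phil x y.
suff /seteqP[_ /(_ x)] : [set z | phi z = phi y] = setT by apply.
apply: Tconn; first by exists y.
  exists [set z | phi z = phi y]; last by rewrite setTI.
  by rewrite openE => z /= <-; exact: phil.
exists [set z | phi z = phi y]; last by rewrite setTI.
rewrite -[X in closed X]setCK closedC openE => z /= zy.
by apply: filterS (phil z) => w /= ->.
Qed.

Lemma loc_const_unit_interval (Z : Type) (phi : I -> Z) :
  (forall u, \forall v \near u, phi v = phi u) -> forall u v, phi u = phi v.
Proof.
move=> phil u v; rewrite -(clampK u) -(clampK v).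
apply: (@loc_const_connected R Z (phi \o clamp)) => [|r].
  exact/connected_intervalP.
exact: (@clamp_continuous r _ (phil (clamp r))).
Qed.

Lemma Imul_subproof (u t : I) : val u * val t \in `[0 : R, 1]%classic.
Proof.
have /andP[u0 u1] := unit_interval_itv u.
have /andP[t0 t1] := unit_interval_itv t.
by rewrite inE /= in_itv /= mulr_ge0//= mulr_ile1.
Qed.

Definition Imul (u t : I) : I :=
  exist (fun x => x \in `[0 : R, 1]%classic) _ (Imul_subproof u t).

Lemma Imul_continuous (T : topologicalType) (f g : T -> I) :
  continuous f -> continuous g -> continuous (fun x => Imul (f x) (g x)).
Proof.
move=> fc gc; apply: continuous_to_unit_interval => x.
suff : (fun x => val (f x) * val (g x) : R) @ x --> val (f x) * val (g x) by [].
have valc := @unit_interval_val_continuous R.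
apply: cvgM; first exact: (continuous_comp (fc x) (valc (f x))).
exact: (continuous_comp (gc x) (valc (g x))).
Qed.

Definition slide (u : I) : continuousType I I :=
  mkcts (Imul_continuous (@cst_continuous I I u) (fun t => @cvg_id I (nbhs t))).

End interval.

(** The tube lemma: since [T] is compact, a bound that holds near every point
    of [{s} * T] holds uniformly over [T] for all parameters near [s]. *)
Lemma curry_supnorm_continuous (R : realType) (A : banachAlgType R)
    (S : topologicalType) (T : compactumType) (h : S -> Cfun T A) :
  continuous (fun p : S * T => h p.1 p.2) -> continuous h.
Proof.
move=> hc s; apply/cvgrPdist_le => e e0.
have e2 : 0 < e / 2 by rewrite divr_gt0.
have /compact_near_coveringP Tcov := @compactum_compact T.
have : \forall s' \near s, [set: T] `<=` (fun t => `|h s t - h s' t| <= e).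
  apply: Tcov => t _.
  have /cvgrPdist_le /(_ _ e2) [[U V] /= [sU tV] UV] := hc (s, t).
  exists (V, U) => // -[t' s'] [/= Vt Us].
  rewrite -(subrK (h s t) (h s t')) -addrA [leRHS](splitr e).
  rewrite (le_trans (ler_normD _ _))// lerD//.
    rewrite distrC; apply: (UV (s, t')); split=> //=; exact: nbhs_singleton.
  exact: (UV (s', t')).
move=> hs; near=> s'.
by apply: supnorm_le => [|t]; [exact: ltW | apply: (near hs s')].
Unshelve. all: by end_near. Qed.

Section sweep.
Context (R : realType) (A : banachAlgType R).
Local Notation I := (unit_interval R).
Local Notation C := (Cfun I A).

Section sweep_along.
Context (S : compactumType) (p : continuousType S I).

Lemma sweep_continuous (b : Cfun unit C) :
  continuous (fun s => Cfun_map A (slide (p s)) (b tt) : C).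
Proof.
apply: curry_supnorm_continuous => -[s t].
apply: (@continuous_comp _ _ _ (fun q : S * I => Imul (p q.1) q.2) (b tt)).
  apply: Imul_continuous => -[s' t']; last exact: cvg_snd.
  exact: (@continuous_comp _ _ _ (@fst S I) p (s', t') cvg_fst
    (@cts_fun _ _ p s')).
exact: Cfun_continuous.
Qed.

(** The single homomorphism that interpolates the contractions by [p s], for
    all [s] at once. The source [Cfun unit C], rather than [C], is where the
    values at the point of a condensed group live. *)
Definition sweep (b : Cfun unit C) : Cfun S C := mkC (@sweep_continuous b).

Lemma sweep_zmod_morphism : zmod_morphism sweep.
Proof. by move=> f g; apply: Cfun_eqP => s; exact: Cfun_eqP. Qed.
Lemma sweep_monoid_morphism : monoid_morphism sweep.
Proof. by split=> [|f g]; apply: Cfun_eqP => s; exact: Cfun_eqP. Qed.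

HB.instance Definition _ := GRing.isZmodMorphism.Build
  (Cfun unit C) (Cfun S C) sweep sweep_zmod_morphism.
HB.instance Definition _ := GRing.isMonoidMorphism.Build
  (Cfun unit C) (Cfun S C) sweep sweep_monoid_morphism.

Definition sweep_map : {rmorphism Cfun unit C -> Cfun S C} := sweep.

End sweep_along.

Section evaluation.
Context (t : I).

Lemma Cev_continuous (b : Cfun unit C) : continuous (fun s => b s t : A).
Proof. by move=> s U /nbhs_singleton Us; exact/principal_filterP. Qed.

Definition Cev (b : Cfun unit C) : Cfun unit A := mkC (@Cev_continuous b).

Lemma Cev_zmod_morphism : zmod_morphism Cev.
Proof. by move=> f g; apply: Cfun_eqP. Qed.
Lemma Cev_monoid_morphism : monoid_morphism Cev.
Proof. by split=> [|f g]; apply: Cfun_eqP. Qed.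

HB.instance Definition _ := GRing.isZmodMorphism.Build
  (Cfun unit C) (Cfun unit A) Cev Cev_zmod_morphism.
HB.instance Definition _ := GRing.isMonoidMorphism.Build
  (Cfun unit C) (Cfun unit A) Cev Cev_monoid_morphism.

Definition Cev_map : {rmorphism Cfun unit C -> Cfun unit A} := Cev.

End evaluation.

(** Both sides are values of one section over the space of ultrafilters on the
    interval: the one obtained by sweeping [z] along the limit map. *)
Lemma slide_action_constant (K : functor Ring Ab) :
  discrete_condensed (fcmp K (Cfun_functor C)) ->
  forall (z : robj K (Cfun unit C)) (u v : I),
  rmap K (sweep_map (cst u : continuousType unit I)) z =
  rmap K (sweep_map (cst v : continuousType unit I)) z.
Proof.
move=> Kdisc z; apply: loc_const_unit_interval.
apply: loc_const_ultra_lim => F.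
pose p : continuousType (stone_cech I) I := mkcts (@ultra_lim_continuous I).
pose KC := fcmp K (Cfun_functor C).
pose y : (KC (stone_cech I : edisType) : zmodType) := rmap K (sweep_map p) z.
have := @discrete_point_values_loc_const KC (stone_cech I) y Kdisc F.
apply: filterS => G.
have E (H : stone_cech I) : point_values y H =
    rmap K (sweep_map (cst (ultra_lim H) : continuousType unit I)) z.
  rewrite -[LHS]/(rmap K
    (Cfun_map C (cst H : continuousType unit (stone_cech I)))
    (rmap K (sweep_map p) z)) -rmap_comp.
  by apply: eq_rmap => b; apply: Cfun_eqP.
by rewrite !E.
Qed.

(** The inverse is evaluation at 0. The composite that is not the identity
    already at the level of rings is the contraction by 0, which acts on [K]
    as the contraction by 1, that is, trivially. *)
Lemma discrete_homotopy_invariant (K : functor Ring Ab) :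
  discrete_condensed (fcmp K (Cfun_functor C)) ->
  is_iso (whisker K (Cfun_const I A) (unit : edisType)).
Proof.
move=> Kdisc.
pose u0 := clamp (0 : R); pose u1 := clamp (1 : R).
have u0E t : Imul u0 t = u0.
  by apply: val_inj; rewrite /= (min_idPr ler01) maxxx mul0r.
have u1E t : Imul u1 t = t.
  by apply: val_inj; rewrite /= minxx (max_idPr ler01) mul1r.
exists (rmap K (Cev_map u0)); split; apply: additive_eqP => z.
  rewrite -[LHS]/(rmap K (Cev_map u0) (rmap K (Cpost_map I A unit) z)).
  rewrite -rmap_comp -[RHS](@rmap_id K).
  by apply: eq_rmap => b; apply: Cfun_eqP.
rewrite -[LHS]/(rmap K (Cpost_map I A unit) (rmap K (Cev_map u0) z)).
rewrite -rmap_comp -[RHS](@rmap_id K).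
transitivity (rmap K (sweep_map (cst u0 : continuousType unit I)) z).
  apply: eq_rmap => b; apply: Cfun_eqP => -[]; apply: Cfun_eqP => t.
  by rewrite -[RHS]/(b tt (Imul u0 t)) u0E.
rewrite (@slide_action_constant K Kdisc z u0 u1).
apply: eq_rmap => b; apply: Cfun_eqP => -[]; apply: Cfun_eqP => t.
by rewrite -[LHS]/(b tt (Imul u1 t)) u1E.
Qed.

End sweep.

Theorem theorem7p5 (R : realType) (A : banachAlgType R) (n : nat)
    (n_ge1 : (1 <= n)%N)
    (discr_Kn : discrete_condensed (Kcond n A))
    (discr_Kn1 : discrete_condensed (Kcond n.-1 A))
    (discr_KnC : discrete_condensed (Kcond n (Cfun (unit_interval R) A))) :
  is_iso (Kcond_const n (unit_interval R) A (unit : edisType)).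
Proof. exact: discrete_homotopy_invariant discr_KnC. Qed.
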